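(* Fix an integer $m\geq 8$ with $m\equiv 2\bmod 6$. Then there exist at most finitely many positive integers $n$ with $n\equiv 0\bmod 6$ such that $\gamma_\rho=1$, where $\gamma_\rho$ is the last non-zero determinantal divisor of the $n\times n$ circulant matrix associated with $f(t)=t^m-t+1$ (that is, for which $H(n,m)^{\mathrm{ab}}\cong\mathbb{Z}^2$).
   Context: The $n\times n$ circulant matrix associated with $f\in\mathbb{Z}[t]$ is the circulant matrix whose first row is $(a_0,\ldots,a_{n-1})$, where $\sum_{i=0}^{n-1}a_it^i$ is the remainder of $f$ modulo $t^n-1$. If its Smith normal form is $\mathrm{diag}_n(s_1,\ldots,s_\rho,0,\ldots,0)$ with $\rho$ its rank, then the last non-zero determinantal divisor is $\gamma_\rho=\prod_{i=1}^\rho s_i$, taken positive. $H(n,m)$ (a Gilbert-Howie group) is the group $\langle x_0,\ldots,x_{n-1}\mid x_ix_{i+m}x_{i+1}^{-1}\ (0\leq i<n)\rangle$, subscripts taken modulo $n$, and $G^{\mathrm{ab}}$ denotes the abelianisation of $G$. *)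

(* Defs.v *)
From HB Require Import structures.
From mathcomp Require Import all_boot all_order perm all_algebra.
From mathcomp Require Import boolp classical_sets cardinality.
Set Implicit Arguments.
Unset Strict Implicit.
Unset Printing Implicit Defensive.
Import Order.TTheory GRing.Theory Num.Theory.

Local Open Scope ring_scope.

(* The entry in row i, column j is the coefficient of index j - i modulo n, *)
(* so that each row is the previous one shifted cyclically to the right.    *)
(* Since 'X^n - 1 is monic, %% on {poly int} is the true remainder.         *)
Definition circulant_mx (n : nat) (f : {poly int}) : 'M[int]_n :=
  \matrix_(i < n, j < n) (f %% ('X^n - 1))`_((j + (n - i)) %% n).

(* Row and column selections range over all maps, not only increasing ones: *)
(* the extra minors are zero or equal to a genuine minor up to sign, hence  *)
(* do not change the gcd.                                                   *)
Definition detdiv (n k : nat) (A : 'M[int]_n) : nat :=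
  \big[gcdn/0%N]_(fg : {ffun 'I_k -> 'I_n} * {ffun 'I_k -> 'I_n})
     `|\det (mxsub fg.1 fg.2 A)|%N.

Definition rank_int (n : nat) (A : 'M[int]_n) : nat :=
  \rank (map_mx (intr : int -> rat) A).

(* The determinantal divisors of index greater than the rank vanish. By     *)
(* smith_last_detdiv below, this one is the product of the non-zero         *)
(* diagonal entries of any Smith normal form.                               *)
Definition last_detdiv (n : nat) (A : 'M[int]_n) : nat :=
  detdiv (rank_int A) A.

Definition smith_diag (n : nat) (s : seq int) : 'M[int]_n :=
  \matrix_(i < n, j < n) (s`_i *+ (i == j :> nat)).

Definition is_smith_normal_form (n : nat) (A : 'M[int]_n) (s : seq int) : Prop :=
  [/\ (size s <= n)%N, all (fun x => 0 < x) s, sorted dvdz s &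
      exists L R : 'M[int]_n,
        [/\ L \in unitmx, R \in unitmx & A = L *m smith_diag n s *m R]].

Section SmithNormalForm.

Lemma det_mul_rect (k n : nat) (B : 'M[int]_(k, n)) (C : 'M[int]_(n, k)) :
  \det (B *m C) =
  \sum_(h : {ffun 'I_k -> 'I_n}) (\prod_i B i (h i)) * \det (rowsub h C).
Proof.
transitivity (\sum_(h : {ffun 'I_k -> 'I_n}) \sum_(s : {perm 'I_k})
   (-1) ^+ s * \prod_i (B i (h i) * C (h i) (s i))).
  rewrite exchange_big; apply: eq_bigr => s _ /=; rewrite -big_distrr /=.
  congr (_ * _); rewrite -(bigA_distr_bigA (fun i j => B i j * C j (s i))) /=.
  by apply: eq_bigr => i _; rewrite mxE.
apply: eq_bigr => h _; rewrite /determinant big_distrr /=.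
apply: eq_bigr => s _; rewrite big_split /= mulrCA; congr (_ * (_ * _)).
by apply: eq_bigr => i _; rewrite !mxE.
Qed.

Lemma detdivP (n k d : nat) (A : 'M[int]_n) :
  reflect (forall f g : {ffun 'I_k -> 'I_n},
             (d%:Z %| \det (mxsub f g A))%Z)
          (d %| detdiv k A)%N.
Proof.
apply: (iffP idP) => [dA f g | dA].
  have: (detdiv k A %| `|\det (mxsub f g A)|)%N.
    by rewrite /detdiv (bigD1 (f, g)) //= dvdn_gcdl.
  by rewrite dvdzE; apply: dvdn_trans.
rewrite /detdiv; elim/big_ind: _ => [|x y dx dy|[f g] _]; rewrite ?dvdn0 //.
  by rewrite dvdn_gcd dx dy.
by have := dA f g; rewrite dvdzE.
Qed.

Lemma detdiv_tr (n k : nat) (A : 'M[int]_n) : detdiv k A^T = detdiv k A.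
Proof.
apply/eqP; rewrite eqn_dvd; apply/andP; split; apply/detdivP => f g.
  by rewrite -det_tr trmx_mxsub; move: g f; apply/detdivP.
by rewrite -trmx_mxsub det_tr; move: g f; apply/detdivP.
Qed.

Lemma detdiv_mull (n k : nat) (L A : 'M[int]_n) :
  (detdiv k A %| detdiv k (L *m A))%N.
Proof.
apply/detdivP => f g.
rewrite mxsub_mul det_mul_rect.
elim/big_ind: _ => [|x y dx dy|h _]; rewrite ?dvdz0 ?rpredD //.
rewrite dvdz_mull //.
have -> : rowsub h (colsub g A) = mxsub h g A by apply/matrixP=> i j; rewrite !mxE.
by move: h g; apply/detdivP.
Qed.

Lemma detdiv_unitl (n k : nat) (L A : 'M[int]_n) :
  L \in unitmx -> detdiv k (L *m A) = detdiv k A.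
Proof.
move=> uL; apply/eqP; rewrite eqn_dvd detdiv_mull andbT.
by rewrite -{2}(mulKmx uL A) detdiv_mull.
Qed.

Lemma detdiv_unitr (n k : nat) (R A : 'M[int]_n) :
  R \in unitmx -> detdiv k (A *m R) = detdiv k A.
Proof.
by move=> uR; rewrite -detdiv_tr trmx_mul detdiv_unitl ?unitmx_tr // detdiv_tr.
Qed.

Lemma rank_smith_diag (n : nat) (s : seq int) :
  (size s <= n)%N -> all (fun x => 0 < x) s ->
  rank_int (smith_diag n s) = size s.
Proof.
move=> sn s0.
pose d : 'rV[rat]_n := \row_i (if (i < size s)%N then (s`_i)%:~R else 1).
have -> : rank_int (smith_diag n s) =
          \rank (diag_mx d *m (pid_mx (size s) : 'M[rat]_n)).
  rewrite /rank_int; congr (\rank _); apply/matrixP => i j.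
  rewrite mul_diag_mx !mxE.
  case: (ltnP i (size s)) => si; rewrite ?andbT ?andbF.
    by case: eqP; rewrite ?mulr1n ?mulr0n ?mulr1 ?mulr0.
  by rewrite nth_default // mul0rn mulr0.
have d_full : row_full (diag_mx d).
  rewrite row_full_unit unitmxE det_diag unitfE prodf_seq_neq0; apply/allP => i _ /=.
  rewrite mxE; case: ifP => // si; rewrite intr_eq0.
  by move/allP: s0 => /(_ _ (mem_nth 0 si)) /lt0r_neq0.
by rewrite (eqmxMfull _ d_full) rank_pid_mx.
Qed.

Lemma detdiv_smith_diag (n : nat) (s : seq int) :
  (size s <= n)%N -> all (fun x => 0 < x) s ->
  (detdiv (size s) (smith_diag n s))%:Z = \prod_(x <- s) x.
Proof.
move=> sn s0; set r := size s.
pose S : 'M[int]_r := diag_mx (\row_i s`_i).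
have detS : \det S = \prod_(x <- s) x.
  rewrite det_diag (big_nth 0) big_mkord.
  by apply: eq_bigr => i _; rewrite mxE.
have S0 : 0 <= \prod_(x <- s) x.
  by rewrite big_seq prodr_ge0 // => x /(allP s0) /ltW.
have factor : smith_diag n s = pid_mx r *m S *m pid_mx r.
  apply/matrixP => i j; rewrite !mxE.
  rewrite (eq_bigr (fun k : 'I_r => s`_k *+ ((i == k :> nat) && (j == k :> nat)))).
    case: (ltnP i r) => [ir|ri]; last first.
      rewrite nth_default // mul0rn big1 // => k _.
      by rewrite (gtn_eqF (leq_trans (ltn_ord k) ri)).
    rewrite (bigD1 (Ordinal ir)) //= eqxx /= eq_sym big1 ?addr0 // => k ki.
    case: eqP => // ik; case/eqP: ki; exact/val_inj.
  move=> k _; rewrite mul_mx_diag !mxE (eq_sym (k : nat)) ltn_ord andbT.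
  case: (eqVneq (j : nat) k) => [_|_]; last first.
    by rewrite andbF mulr0n mulr0.
  case: (eqVneq (i : nat) k) => [->|_]; last by rewrite mulr0n !mul0r.
  by rewrite ltn_ord mul1r mulr1.
apply/eqP; rewrite -(gez0_abs S0) eqz_nat eqn_dvd; apply/andP; split.
  pose h : {ffun 'I_r -> 'I_n} := [ffun i => widen_ord sn i].
  have /detdivP/(_ h h) := dvdnn (detdiv r (smith_diag n s)).
  suff -> : mxsub h h (smith_diag n s) = S by rewrite detS dvdzE.
  apply/matrixP => i j; rewrite !mxE !ffunE /=.
  by [].
apply/detdivP => f g; rewrite factor mxsub_mul -[rowsub f _]/(mxsub f id _).
rewrite (mxsub_mul f id) !det_mulmx dvdz_mulr // dvdz_mull //.
have -> : colsub id S = S by apply/matrixP => i j; rewrite mxE.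
by rewrite detS gez0_abs.
Qed.

Lemma rank_int_unit (n : nat) (L A R : 'M[int]_n) :
  L \in unitmx -> R \in unitmx -> rank_int (L *m A *m R) = rank_int A.
Proof.
move=> uL uR; have map_unit (M : 'M[int]_n) : M \in unitmx ->
    map_mx (intr : int -> rat) M \in unitmx.
  by rewrite !unitmxE det_map_mx; apply: rmorph_unit.
rewrite /rank_int !map_mxM mxrankMfree ?row_free_unit ?map_unit //.
by rewrite (eqmxMfull _ _) // row_full_unit map_unit.
Qed.

Lemma smith_rank (n : nat) (A : 'M[int]_n) (s : seq int) :
  is_smith_normal_form A s -> rank_int A = size s.
Proof.
by case=> sn s0 _ [L [R [uL uR ->]]]; rewrite rank_int_unit ?rank_smith_diag.
Qed.

Lemma smith_last_detdiv (n : nat) (A : 'M[int]_n) (s : seq int) :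
  is_smith_normal_form A s -> (last_detdiv A)%:Z = \prod_(x <- s) x.
Proof.
move=> As; rewrite /last_detdiv (smith_rank As).
case: As => sn s0 _ [L [R [uL uR ->]]].
by rewrite detdiv_unitr // detdiv_unitl // detdiv_smith_diag.
Qed.

End SmithNormalForm.

Section PresentedGroup.
Variables (X : choiceType) (rel : set (seq (X * bool))).

(* A letter (x, true) stands for the generator x, (x, false) for x^-1. *)
Definition word_inv (w : seq (X * bool)) : seq (X * bool) :=
  rev [seq (a.1, ~~ a.2) | a <- w].

Inductive word_eq : seq (X * bool) -> seq (X * bool) -> Prop :=
| WordRefl u : word_eq u u
| WordSym u v : word_eq u v -> word_eq v u
| WordTrans u v w : word_eq u v -> word_eq v w -> word_eq u w
| WordCat u u' v v' : word_eq u u' -> word_eq v v' -> word_eq (u ++ v) (u' ++ v')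
| WordCancel x b : word_eq [:: (x, b); (x, ~~ b)] [::]
| WordRel r : rel r -> word_eq r [::].

Definition word_eqb (u v : seq (X * bool)) : bool := `[< word_eq u v >].

Lemma word_eqb_refl : reflexive word_eqb.
Proof. by move=> u; apply/asboolP/WordRefl. Qed.

Lemma word_eqb_sym : symmetric word_eqb.
Proof. by move=> u v; apply/asboolP/asboolP; apply: WordSym. Qed.

Lemma word_eqb_trans : transitive word_eqb.
Proof.
move=> v u w /asboolP uv /asboolP vw; apply/asboolP; exact: WordTrans uv vw.
Qed.

Definition word_equiv : equiv_rel (seq (X * bool)) :=
  EquivRel word_eqb word_eqb_refl word_eqb_sym word_eqb_trans.

Definition presented : Type := {eq_quot word_equiv}%qT.

HB.instance Definition _ := Choice.on presented.
HB.instance Definition _ := EqQuotient.on presented.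

Definition pclass (w : seq (X * bool)) : presented := (\pi_presented w)%qT.

Lemma pclassP (u v : seq (X * bool)) : pclass u = pclass v <-> word_eq u v.
Proof.
split=> [/eqP|uv]; first by rewrite eqmodE => /asboolP.
by apply/eqP; rewrite eqmodE; apply/asboolP.
Qed.

Definition pone : presented := pclass [::].
Definition pmul (g h : presented) : presented := pclass (repr g ++ repr h).
Definition pinv (g : presented) : presented := pclass (word_inv (repr g)).

Lemma repr_pclass (u : seq (X * bool)) : word_eq (repr (pclass u)) u.
Proof. by apply/pclassP; rewrite /pclass reprK. Qed.

Lemma pclassK (g : presented) : pclass (repr g) = g.
Proof. by rewrite /pclass reprK. Qed.

Lemma pclass_cat (u v : seq (X * bool)) :
  pclass (u ++ v) = pmul (pclass u) (pclass v).
Proof. by apply/pclassP/WordCat; apply/WordSym/repr_pclass. Qed.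

Lemma word_mulV (u : seq (X * bool)) : word_eq (u ++ word_inv u) [::].
Proof.
elim: u => [|[x b] u IH]; first exact: WordRefl.
rewrite /word_inv /= rev_cons -cats1 catA -cat_cons -cat1s.
rewrite -catA -/(word_inv u).
apply: WordTrans (WordCancel x b).
apply: (WordCat (WordRefl [:: (x, b)])).
exact: (WordCat IH (WordRefl [:: (x, ~~ b)])).
Qed.

Lemma word_invK : involutive word_inv.
Proof.
move=> u; rewrite /word_inv map_rev revK -map_comp.
by rewrite -[RHS]map_id; apply: eq_map => -[x b] /=; rewrite negbK.
Qed.

Lemma pmulA : associative pmul.
Proof.
move=> g h k; rewrite -(pclassK g) -(pclassK h) -(pclassK k).
by rewrite -!pclass_cat catA.
Qed.

Lemma pmul1 : left_id pone pmul.
Proof. by move=> g; rewrite -(pclassK g) -pclass_cat. Qed.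

Lemma pmulr1 : right_id pone pmul.
Proof. by move=> g; rewrite -(pclassK g) -pclass_cat cats0. Qed.

Lemma pmulrV : right_inverse pone pinv pmul.
Proof.
move=> g; rewrite -{1}(pclassK g) -pclass_cat; apply/pclassP; exact: word_mulV.
Qed.

Lemma pmulV : left_inverse pone pinv pmul.
Proof.
move=> g; rewrite -{2}(pclassK g) -pclass_cat; apply/pclassP.
by rewrite -{2}[repr g]word_invK; exact: word_mulV.
Qed.

HB.instance Definition _ :=
  isGroup.Build presented pmulA pmul1 pmulr1 pmulV pmulrV.

End PresentedGroup.

Section Abelianization.
Variable G : groupType.
Local Open Scope group_scope.

Inductive derived : G -> Prop :=
| DerivedComm x y : derived [~ x, y]
| DerivedOne : derived 1
| DerivedMul x y : derived x -> derived y -> derived (x * y)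
| DerivedInv x : derived x -> derived x^-1.

Lemma derivedJ (x y : G) : derived x -> derived (x ^ y).
Proof.
move=> dx; have -> : x ^ y = x * [~ x, y] by rewrite mulVKg.
by apply: DerivedMul => //; apply: DerivedComm.
Qed.

Definition ab_eqb (x y : G) : bool := `[< derived (x^-1 * y) >].

Lemma ab_eqb_refl : reflexive ab_eqb.
Proof. by move=> x; apply/asboolP; rewrite mulVg; apply: DerivedOne. Qed.

Lemma ab_eqb_sym : symmetric ab_eqb.
Proof.
by move=> x y; apply/asboolP/asboolP => /DerivedInv; rewrite invgM invgK.
Qed.

Lemma ab_eqb_trans : transitive ab_eqb.
Proof.
move=> y x z /asboolP xy /asboolP yz; apply/asboolP.
by have := DerivedMul xy yz; rewrite -mulgA mulVKg.
Qed.

Definition ab_equiv : equiv_rel G :=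
  EquivRel ab_eqb ab_eqb_refl ab_eqb_sym ab_eqb_trans.

Definition abelianization : Type := {eq_quot ab_equiv}%qT.

HB.instance Definition _ := Choice.on abelianization.
HB.instance Definition _ := EqQuotient.on abelianization.

Definition abclass (x : G) : abelianization := (\pi_abelianization x)%qT.

Lemma abclassP (x y : G) : abclass x = abclass y <-> derived (x^-1 * y).
Proof.
split=> [/eqP|xy]; first by rewrite eqmodE => /asboolP.
by apply/eqP; rewrite eqmodE; apply/asboolP.
Qed.

Lemma abclassK (a : abelianization) : abclass (repr a) = a.
Proof. by rewrite /abclass reprK. Qed.

Definition ab_zero : abelianization := abclass 1.
Definition ab_add (a b : abelianization) : abelianization :=
  abclass (repr a * repr b).
Definition ab_opp (a : abelianization) : abelianization := abclass (repr a)^-1.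

Lemma abclassM (x y : G) : abclass (x * y) = ab_add (abclass x) (abclass y).
Proof.
apply/esym/abclassP; set x' := repr _; set y' := repr _.
have dx : derived (x'^-1 * x) by apply/abclassP; exact: abclassK.
have dy : derived (y'^-1 * y) by apply/abclassP; exact: abclassK.
have -> : (x' * y')^-1 * (x * y) = (x'^-1 * x) ^ y' * (y'^-1 * y).
  by rewrite invgM /conjg !mulgA mulgK.
exact: DerivedMul (derivedJ _ dx) dy.
Qed.

Lemma ab_addA : associative ab_add.
Proof.
move=> a b c; rewrite -(abclassK a) -(abclassK b) -(abclassK c).
by rewrite -!abclassM mulgA.
Qed.

Lemma ab_addC : commutative ab_add.
Proof.
move=> a b; rewrite -(abclassK a) -(abclassK b) -!abclassM.
apply/abclassP; have -> : (repr a * repr b)^-1 * (repr b * repr a) =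
  [~ repr b, repr a] by rewrite invgM /commg /conjg !mulgA.
exact: DerivedComm.
Qed.

Lemma ab_add0 : left_id ab_zero ab_add.
Proof. by move=> a; rewrite -(abclassK a) -abclassM mul1g. Qed.

Lemma ab_addN : left_inverse ab_zero ab_opp ab_add.
Proof. by move=> a; rewrite -{2}(abclassK a) -abclassM mulVg. Qed.

HB.instance Definition _ :=
  Algebra.isZmodule.Build abelianization ab_addA ab_addC ab_add0 ab_addN.

End Abelianization.

Definition ord_shift (n k : nat) (i : 'I_n) : 'I_n :=
  Ordinal (ltn_pmod (i + k) (leq_ltn_trans (leq0n i) (ltn_ord i))).

Definition GH_relators (n m : nat) : set (seq ('I_n * bool)) :=
  [set w | exists i : 'I_n,
     w = [:: (i, true); (ord_shift m i, true); (ord_shift 1 i, false)]].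

Definition gilbert_howie (n m : nat) : groupType := presented (@GH_relators n m).

Definition zmod_iso (U V : zmodType) : Prop :=
  exists phi : {additive U -> V}, bijective phi.

(* Main.v *)
(* Write Phi = X^2 - X + 1, f = X^m - X + 1 = Phi g and X^n - 1 = Phi h. The
   rows of the circulant matrix span the image of the ideal (f, X^n - 1) in
   Z[X]/(X^n - 1), and H(n, m)^ab is the quotient by that lattice. By the Smith
   normal form, the last non-zero determinantal divisor is 1 exactly when the
   quotient is torsion free. As g and h have no common complex root, some
   non-zero multiple of Phi lies in (f, X^n - 1), so in the torsion-free case Phi
   itself does: the quotient is Z[X]/(Phi), which is Z^2, and a g + b h = 1 for
   some integer polynomials a, b. If M is the companion matrix of g, then h(M) is
   invertible over Z, so |det (M^n - 1)| = |det Phi(M)| does not depend on n. But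
   |det (M^n - 1)| is the product of the |alpha^n - 1| over the roots alpha of g,
   none of which lies on the unit circle; their product being 1 in absolute value,
   one of them lies outside, and this product grows at least linearly in n. *)
Require Import Defs.
From HB Require Import structures.
From mathcomp Require Import all_boot all_order all_algebra all_field.
From mathcomp Require Import boolp classical_sets cardinality.
From mathcomp Require Import ring zify.
Set Implicit Arguments.
Unset Strict Implicit.
Unset Printing Implicit Defensive.
Import Order.TTheory GRing.Theory Num.Theory.
Local Open Scope ring_scope.

(** * Saturated row lattices *)

Definition row_lattice (n : nat) (A : 'M[int]_n) (v : 'rV[int]_n) : Prop :=
  exists u : 'rV[int]_n, v = u *m A.

(** Equivalently, the quotient of [Z^n] by the row lattice is torsion free. *)
Definition saturated (n : nat) (A : 'M[int]_n) : Prop :=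
  forall (k : int) (v : 'rV[int]_n),
    k != 0 -> row_lattice A (k *: v) -> row_lattice A v.

(** The form given by [int_Smith_normal_form] may have signs and zeros on its diagonal. In a
    divisibility chain everything after the first zero vanishes, so the chain is cut there; the
    signs move into the left factor. *)
Lemma smith_normal_form_exists (n : nat) (A : 'M[int]_n) :
  exists s : seq int, is_smith_normal_form A s.
Proof.
have [L uL [R uR [d dS defA]]] := int_Smith_normal_form A.
pose e := take n d; pose r := index 0 e; pose s := [seq `|x| | x <- take r e].
have sz_e : (size e <= n)%N by rewrite size_take_min geq_minl.
have r_le : (r <= size e)%N by apply: index_size.
have sz_s : size s = r by rewrite size_map size_takel.
have e_nth i : (i < n)%N -> e`_i = d`_i by move=> ?; rewrite nth_take.
have eS : sorted dvdz e by apply: take_sorted.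
have s_nth i : (i < n)%N -> s`_i = `|d`_i|.
  move=> i_n; case: (ltnP i r) => ir.
    rewrite (nth_map 0); first by rewrite nth_take // e_nth.
    by rewrite size_takel.
  rewrite nth_default ?sz_s // -e_nth //.
  case: (ltnP i (size e)) => ie; last by rewrite nth_default // normr0.
  have er : e`_r = 0 by apply: nth_index; rewrite -index_mem (leq_ltn_trans ir).
  move: ir; rewrite leq_eqVlt => /predU1P [<-|ir]; first by rewrite er normr0.
  have trD : transitive (dvdz : rel int) by move=> y x z; apply: dvdz_trans.
  have := sorted_ltn_nth trD 0 eS r i.
  rewrite !inE ie (ltn_trans ir) // => /(_ isT isT ir).
  by rewrite er -[dvdz _ _]/(0 %| _)%Z dvd0z => /eqP ->; rewrite normr0.
exists s; split.
- by rewrite sz_s (leq_trans r_le).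
- rewrite all_map; apply/(all_nthP 0) => i; rewrite size_takel // => ir.
  rewrite nth_take //= normr_gt0.
  by have := before_find 0 ir; rewrite /= => ->.
- rewrite sorted_map (eq_sorted (e' := dvdz)); first exact: take_sorted.
  by move=> x y; rewrite /= -!abszE.
pose D : 'rV[int]_n := \row_i (if d`_i < 0 then -1 else 1).
exists (L *m diag_mx D), R; split=> //.
  rewrite unitmx_mul uL unitmxE det_diag rpred_prod // => i _.
  by rewrite mxE; case: ifP.
rewrite defA; congr (_ *m R); rewrite -mulmxA; congr (L *m _).
apply/matrixP => i j; rewrite mul_diag_mx !mxE s_nth //.
case: (_ == _); rewrite ?mulr1n ?mulr0n ?mulr0 //.
by case: ltrP => d0; [rewrite ltr0_norm // mulN1r opprK | rewrite mul1r ger0_norm].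
Qed.

Lemma pos_mul_eq1 (x y : int) : 0 < x -> x * y = 1 -> x = 1.
Proof.
move=> x0 xy1; have := dvdz_mulr y (dvdzz x).
by rewrite xy1 dvdz1; lia.
Qed.

(** In the coordinates given by [R], the lattice is a sum of the subgroups [s_i Z], one for each of
    the first coordinates, so it is saturated exactly when every [s_i] is 1. *)
Lemma last_detdiv_eq1 (n : nat) (A : 'M[int]_n) :
  last_detdiv A = 1%N <-> saturated A.
Proof.
have [s As] := smith_normal_form_exists A.
have prod_s := smith_last_detdiv As.
case: As => sn s0 _ [L [R [uL uR defA]]].
have smith_row (u : 'rV[int]_n) i : (u *m smith_diag n s) 0 i = u 0 i * s`_i.
  rewrite mxE (bigD1 i) //= big1 ?addr0 => [|j ji]; rewrite mxE ?eqxx //.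
  case: eqP => [/val_inj ij|]; first by rewrite ij eqxx in ji.
  by rewrite mulr0n mulr0.
have lattE v : row_lattice A v <-> exists u, v *m invmx R = u *m smith_diag n s.
  split=> [[u ->]|[u vu]].
    by exists (u *m L); rewrite defA !mulmxA mulmxK.
  by exists (u *m invmx L); rewrite defA !mulmxA mulmxKV // -vu mulmxKV.
split=> [ld1|satA].
  have s1 i : (i < size s)%N -> s`_i = 1.
    move=> i_s; move: prod_s; rewrite ld1 (big_nth 0) big_mkord.
    rewrite (bigD1 (Ordinal i_s)) //= => /esym prod1.
    apply: (pos_mul_eq1 _ prod1).
    by apply: (allP s0); apply: mem_nth.
  move=> k v k0 /lattE [u kv]; apply/lattE; exists (v *m invmx R).
  apply/rowP => i; rewrite smith_row.
  move/rowP/(_ i): kv; rewrite smith_row -scalemxAl mxE.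
  case: (ltnP i (size s)) => si; first by rewrite s1 ?mulr1.
  by rewrite nth_default // !mulr0 => /eqP; rewrite mulf_eq0 (negPf k0) => /eqP.
suff s1 x : x \in s -> x = 1.
  by apply/eqP; rewrite -eqz_nat prod_s big_seq big1.
move=> /(nthP 0) [i i_s <-].
have s_i0 : 0 < s`_i by apply: (allP s0); apply: mem_nth.
pose o : 'I_n := Ordinal (leq_trans i_s sn).
(* The multiple of [v] by the [i]-th entry of [s] lies in the lattice; by saturation so does [v],
   and that entry divides 1. *)
pose v : 'rV[int]_n := delta_mx 0 o *m R.
have /lattE [u /rowP/(_ o)] : row_lattice A v.
  apply: (satA s`_i); first exact: lt0r_neq0.
  apply/lattE; exists (delta_mx 0 o); rewrite -scalemxAl mulmxK //.
  apply/rowP => j; rewrite smith_row !mxE eqxx /=.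
  by case: eqP => [->|_]; rewrite ?mulr1 ?mul1r ?mulr0 ?mul0r.
rewrite smith_row mulmxK // mxE !eqxx => us.
by apply: (pos_mul_eq1 s_i0 (y := u 0 o)); rewrite mulrC -us.
Qed.

(** * Circulant matrices and [Z[X]/(X^n - 1)] *)

(** Coordinates of the class of [p] in [Z[X]/(X^n - 1)], in the basis of powers of [X]. *)
Definition cyclic_row (n : nat) (p : {poly int}) : 'rV[int]_n :=
  poly_rV (p %% ('X^n - 1)).

Section CyclicRow.

Variables (n : nat) (n_gt0 : (0 < n)%N).

Let modulus_unit : lead_coef ('X^n - 1 : {poly int}) \is a GRing.unit.
Proof. by rewrite -polyC1 lead_coefXnsubC. Qed.

Let size_modulus : size ('X^n - 1 : {poly int}) = n.+1.
Proof. by rewrite -polyC1 size_XnsubC. Qed.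

Let size_modp (p : {poly int}) : (size (p %% ('X^n - 1))%R <= n)%N.
Proof. by rewrite -ltnS -size_modulus ltn_modp -size_poly_gt0 size_modulus. Qed.

Lemma cyclic_row_is_linear : linear (cyclic_row n).
Proof.
move=> a p q; rewrite /cyclic_row Pdiv.IdomainUnit.modpD //.
by rewrite Pdiv.IdomainUnit.modpZl // linearP.
Qed.
HB.instance Definition _ :=
  GRing.isLinear.Build _ _ _ _ (cyclic_row n) cyclic_row_is_linear.

Lemma cyclic_row_mod (p q : {poly int}) :
  cyclic_row n (p + q * ('X^n - 1)) = cyclic_row n p.
Proof.
by rewrite /cyclic_row Pdiv.IdomainUnit.modpD // modp_mull addr0.
Qed.

Lemma cyclic_rowK (v : 'rV[int]_n) : cyclic_row n (rVpoly v) = v.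
Proof.
by rewrite /cyclic_row modp_small ?rVpolyK // size_modulus ltnS size_poly.
Qed.

Lemma rVpoly_cyclic_row (p : {poly int}) :
  exists q, rVpoly (cyclic_row n p) = p + q * ('X^n - 1).
Proof.
exists (- (p %/ ('X^n - 1))); rewrite poly_rV_K //.
by rewrite {2}(Pdiv.IdomainUnit.divp_eq modulus_unit p) mulNr addrAC subrr add0r.
Qed.

Lemma cyclic_row_Xn (k : nat) (j : 'I_n) :
  j = (k %% n)%N :> nat -> cyclic_row n 'X^k = delta_mx 0 j.
Proof.
move=> jk.
have -> : delta_mx 0 j = cyclic_row n 'X^j.
  by rewrite -rVpoly_delta cyclic_rowK.
(* The difference is [X^j] times [(X^n)^(k %/ n) - 1], which a geometric sum factors. *)
have -> : 'X^k = 'X^j + ('X^j * \sum_(i < k %/ n) ('X^n) ^+ i) * ('X^n - 1)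
    :> {poly int}.
  rewrite -mulrA [_ * ('X^n - 1)]mulrC -subrX1 mulrBr mulr1 addrC subrK.
  by rewrite -exprM -exprD jk mulnC addnC -divn_eq.
by rewrite cyclic_row_mod.
Qed.

Lemma row_circulant (f : {poly int}) (i : 'I_n) :
  row i (circulant_mx n f) = cyclic_row n ('X^i * f).
Proof.
pose r := f %% ('X^n - 1).
have -> : 'X^i * f = 'X^i * r + ('X^i * (f %/ ('X^n - 1))) * ('X^n - 1).
  rewrite {1}(Pdiv.IdomainUnit.divp_eq modulus_unit f) mulrDr -/r.
  by rewrite addrC !mulrA.
rewrite cyclic_row_mod.
have {1}-> : r = \sum_(k < n) r`_k *: 'X^k.
  by rewrite -poly_def; apply/polyP => k; rewrite coef_poly; case: ltnP => // nk;
    rewrite nth_default // (leq_trans (size_modp f)).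
rewrite mulr_sumr linear_sum /=; apply/rowP => j; rewrite !mxE summxE.
have lt_c : ((j + (n - i)) %% n < n)%N by rewrite ltn_mod.
(* Only the power [X^k] with [i + k = j] modulo [n] reaches column [j]; as [i < n], the subtraction
   [n - i] is not truncated. *)
rewrite (bigD1 (Ordinal lt_c)) //= big1 ?addr0 => [|k k_neq].
  rewrite -scalerAr linearZ /= -exprD (@cyclic_row_Xn _ j) ?mxE ?eqxx ?mulr1 //.
  rewrite modnDmr addnA [(i + j)%N]addnC -addnA subnKC ?modnDr ?modn_small //.
  exact: ltnW.
have lt_ik : ((i + k) %% n < n)%N by rewrite ltn_mod.
rewrite -scalerAr linearZ /= -exprD (@cyclic_row_Xn _ (Ordinal lt_ik)) // !mxE eqxx /=.
case: eqP => [jik|]; last by rewrite mulr0.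
case/eqP: k_neq; apply: val_inj; rewrite /= jik /= modnDml.
rewrite addnAC subnKC; last exact: ltnW.
by rewrite modnDl modn_small.
Qed.

Lemma mul_circulant (f : {poly int}) (u : 'rV[int]_n) :
  u *m circulant_mx n f = cyclic_row n (rVpoly u * f).
Proof.
rewrite mulmx_sum_row.
have {2}-> : u = \sum_i u 0 i *: delta_mx 0 i by rewrite -row_sum_delta.
rewrite linear_sum /= mulr_suml linear_sum /=; apply: eq_bigr => i _.
by rewrite row_circulant linearZ /= -scalerAl linearZ /= rVpoly_delta.
Qed.

(** The circulant matrix acts on rows as multiplication by [f] in [Z[X]/(X^n - 1)], and every class
    there is represented by some [rVpoly u]. *)
Lemma row_lattice_circulant (f p : {poly int}) :
  row_lattice (circulant_mx n f) (cyclic_row n p) <->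
  exists a b : {poly int}, p = a * f + b * ('X^n - 1).
Proof.
split=> [[u pu]|[a [b ->]]]; last first.
  exists (cyclic_row n a); rewrite mul_circulant cyclic_row_mod.
  have [q ->] := rVpoly_cyclic_row a.
  by rewrite mulrDl mulrAC cyclic_row_mod.
have [q1 e1] := rVpoly_cyclic_row p.
have [q2 e2] := rVpoly_cyclic_row (rVpoly u * f).
exists (rVpoly u), (q2 - q1).
rewrite mul_circulant in pu; move: e1; rewrite pu e2 => e.
by rewrite mulrBl addrA e addrK.
Qed.

End CyclicRow.

(** * The abelianisation of a presented group *)

Lemma row_latticeB (n : nat) (A : 'M[int]_n) (v w : 'rV[int]_n) :
  row_lattice A v -> row_lattice A w -> row_lattice A (v - w).
Proof. by move=> [u ->] [x ->]; exists (u - x); rewrite mulmxBl. Qed.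

Lemma row_lattice0 (n : nat) (A : 'M[int]_n) : row_lattice A 0.
Proof. by exists 0; rewrite mul0mx. Qed.

Lemma row_latticeN (n : nat) (A : 'M[int]_n) (v : 'rV[int]_n) :
  row_lattice A v -> row_lattice A (- v).
Proof. by move=> [u ->]; exists (- u); rewrite mulNmx. Qed.

Lemma row_latticeD (n : nat) (A : 'M[int]_n) (v w : 'rV[int]_n) :
  row_lattice A v -> row_lattice A w -> row_lattice A (v + w).
Proof. by move=> [u ->] [x ->]; exists (u + x); rewrite mulmxDl. Qed.

Definition letter_exponent (n : nat) (a : 'I_n * bool) : 'rV[int]_n :=
  if a.2 then delta_mx 0 a.1 else - delta_mx 0 a.1.

(** The image of a word in [Z^n], the abelianised free group. *)
Definition exponents (n : nat) (w : seq ('I_n * bool)) : 'rV[int]_n :=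
  \sum_(a <- w) letter_exponent a.

Section PresentedAbelianization.

Variables (n : nat) (rel : set (seq ('I_n * bool))) (A : 'M[int]_n).
Hypothesis rel_lattice : forall w, rel w -> row_lattice A (exponents w).
Hypothesis row_rel : forall i, exists2 w, rel w & row i A = exponents w.

Local Notation G := (presented rel).
Local Notation Gab := (abelianization G).

Lemma exponents_cat (u v : seq ('I_n * bool)) :
  exponents (u ++ v) = exponents u + exponents v.
Proof. exact: big_cat. Qed.

Lemma exponents_inv (w : seq ('I_n * bool)) :
  exponents (word_inv w) = - exponents w.
Proof.
rewrite /exponents (perm_big [seq (a.1, ~~ a.2) | a <- w]) ?perm_rev //=.
rewrite big_map -sumrN; apply: eq_bigr => -[i []] _ //.
by rewrite /letter_exponent opprK.
Qed.

Lemma exponents_surj (v : 'rV[int]_n) : exists w, exponents w = v.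
Proof.
pose P (v : 'rV[int]_n) := exists w, exponents w = v.
have P0 : P 0 by exists [::]; rewrite /exponents big_nil.
have PD u w : P u -> P w -> P (u + w).
  by move=> [x <-] [y <-]; exists (x ++ y); rewrite exponents_cat.
have PN u : P u -> P (- u) by move=> [x <-]; exists (word_inv x); rewrite exponents_inv.
rewrite -/(P v) [v]row_sum_delta; apply: big_ind => // i _.
have P1 : P (delta_mx 0 i).
  by exists [:: (i, true)]; rewrite /exponents big_seq1.
have Pn k : P (delta_mx 0 i *+ k) by elim: k => // k IH; rewrite mulrS; apply: PD.
rewrite -[v 0 i]intz scaler_int; case: (v 0 i) => k; first exact: Pn.
by rewrite NegzE mulrNz; apply: PN; apply: Pn.
Qed.

(** Cancellations preserve the exponent vector and relators change it by a lattice vector, so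
    exponents are well defined on the group modulo the lattice. *)
Lemma word_eq_lattice (u v : seq ('I_n * bool)) :
  word_eq rel u v -> row_lattice A (exponents u - exponents v).
Proof.
elim=> {u v} [u|u v _ IH|u v w _ IH1 _ IH2|u u' v v' _ IH1 _ IH2|x b|r rr].
- by rewrite subrr; apply: row_lattice0.
- by rewrite -opprB; apply: row_latticeN.
- by rewrite -(subrK (exponents v) (exponents u)) -addrA; apply: row_latticeD.
- by rewrite !exponents_cat opprD addrACA; apply: row_latticeD.
- rewrite /exponents big_cons big_seq1 big_nil subr0 /letter_exponent /=.
  by case: b => /=; rewrite ?subrr ?addNr; apply: row_lattice0.
- by rewrite [exponents [::]]big_nil subr0; apply: rel_lattice.
Qed.

Lemma repr_lattice (w : seq ('I_n * bool)) :
  row_lattice A (exponents (repr (pclass rel w))) <-> row_lattice A (exponents w).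
Proof.
have := word_eq_lattice (repr_pclass rel w); set e := exponents (repr _) => ew.
split=> [/row_latticeB/(_ ew)|/row_latticeD/(_ ew)].
  by rewrite opprB addrC subrK.
by rewrite addrC subrK.
Qed.

Lemma derived_lattice (x : G) : derived x -> row_lattice A (exponents (repr x)).
Proof.
have exponentsM (g h : G) : row_lattice A (exponents (repr (g * h)%g)) <->
    row_lattice A (exponents (repr g) + exponents (repr h)).
  by rewrite -exponents_cat; apply: repr_lattice.
have exponentsV (g : G) : row_lattice A (exponents (repr (g^-1)%g)) <->
    row_lattice A (- exponents (repr g)).
  by rewrite -exponents_inv; apply: repr_lattice.
elim=> {x} [x y||x y _ IHx _ IHy|x _ IHx].
- have -> : [~ x, y]%g = pclass rel (word_inv (repr x) ++
      (word_inv (repr y) ++ (repr x ++ repr y))).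
    by rewrite !pclass_cat !pclassK.
  apply/repr_lattice; rewrite !exponents_cat !exponents_inv.
  rewrite [- exponents (repr y) + _]addrC addrK addNr.
  exact: row_lattice0.
- by apply/repr_lattice; rewrite [exponents [::]]big_nil; apply: row_lattice0.
- by apply/exponentsM; apply: row_latticeD.
- by apply/exponentsV; apply: row_latticeN.
Qed.

Definition ab_of (v : 'rV[int]_n) : Gab :=
  \sum_i abclass (pclass rel [:: (i, true)]) *~ v 0 i.

Lemma ab_of_is_additive : zmod_morphism ab_of.
Proof.
move=> u v; rewrite /ab_of -sumrB; apply: eq_bigr => i _.
by rewrite !mxE mulrzBr.
Qed.
HB.instance Definition _ :=
  GRing.isZmodMorphism.Build _ _ ab_of ab_of_is_additive.

Lemma ab_of_exponents (w : seq ('I_n * bool)) :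
  ab_of (exponents w) = abclass (pclass rel w).
Proof.
have ab1 : abclass (pclass rel [::]) = 0 :> Gab by [].
have abM u v : abclass (pclass rel (u ++ v)) =
    abclass (pclass rel u) + abclass (pclass rel v) :> Gab.
  by rewrite pclass_cat; apply: abclassM.
have ab_delta i : ab_of (delta_mx 0 i) = abclass (pclass rel [:: (i, true)]).
  rewrite /ab_of (bigD1 i) //= big1 ?addr0 => [|j ji]; rewrite !mxE ?eqxx //.
  by rewrite (negPf ji) mulr0z.
elim: w => [|[i b] w IH]; first by rewrite /exponents big_nil raddf0.
rewrite -cat1s exponents_cat abM raddfD /= IH; congr (_ + _).
rewrite /exponents big_seq1 /letter_exponent /=; case: b => /=; first exact: ab_delta.
rewrite raddfN /= ab_delta; apply/eqP; rewrite eq_sym -addr_eq0 -abM.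
by rewrite -ab1; apply/eqP; congr abclass; apply/pclassP; apply: (WordCancel _ i false).
Qed.

(** Since [repr] picks an arbitrary word, this section of [ab_of] can be expected to be additive
    only modulo the row lattice. *)
Definition ab_exponents (a : Gab) : 'rV[int]_n := exponents (repr (repr a : G)).

Lemma ab_exponentsK : cancel ab_exponents ab_of.
Proof. by move=> a; rewrite ab_of_exponents pclassK abclassK. Qed.

(** The rows of [A] are exponent vectors of relators, hence die in the abelianisation. Conversely, a
    word with trivial class represents a derived element, whose exponents lie in the lattice. So the
    abelianisation is [Z^n] modulo the row lattice. *)
Lemma ab_of_eq0 (v : 'rV[int]_n) : ab_of v = 0 <-> row_lattice A v.
Proof.
split=> [|[u ->]]; last first.
  rewrite mulmx_sum_row raddf_sum big1 // => i _.
  have [w rw ->] := row_rel i.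
  rewrite -[u 0 i]intz scaler_int raddfMz /= ab_of_exponents.
  suff -> : abclass (pclass rel w) = 0 :> Gab by rewrite mul0rz.
  by congr abclass; apply/pclassP; apply: WordRel.
have [w <-] := exponents_surj v; rewrite ab_of_exponents => w0.
have /abclassP/DerivedInv : abclass (pclass rel w) = abclass (1%g : G) by [].
by rewrite mulg1 invgK => /derived_lattice/repr_lattice.
Qed.

(** If [k *: v] is in the lattice, [ab_of v] is a torsion element, and [Z^2] has no torsion. *)
Lemma zmod_iso_saturated :
  zmod_iso Gab (int * int)%type -> saturated A.
Proof.
move=> [phi /bij_inj phi_inj] k v k0 /ab_of_eq0.
rewrite -[k in k *: v]intz scaler_int raddfMz /= => kv0; apply/ab_of_eq0.
apply: phi_inj; rewrite raddf0.
have := congr1 phi kv0; rewrite raddfMz raddf0.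
have pair_mulz (p : int * int) (l : int) : p *~ l = (p.1 *~ l, p.2 *~ l).
  by rewrite [LHS]surjective_pairing; congr pair;
    [exact: (raddfMz fst) | exact: (raddfMz snd)].
rewrite [phi _]surjective_pairing pair_mulz => -[] /eqP + /eqP.
by rewrite !mulrz_eq0 (negPf k0) => /eqP -> /eqP ->.
Qed.

(** The remainder modulo [q] is a linear polynomial, that is, a pair of integers, and it vanishes
    exactly on the lattice. The bound [1 < n] lets every linear polynomial fit into a row. *)
Lemma quadratic_quotient_zmod_iso (q : {poly int}) :
    (1 < n)%N -> q \is monic -> size q = 3%N ->
    (forall v, row_lattice A v <-> rVpoly v %% q = 0) ->
  zmod_iso Gab (int * int)%type.
Proof.
move=> n_gt1 q_monic q_size latE.
have q_unit : lead_coef q \is a GRing.unit by rewrite (monicP q_monic) unitr1.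
have modB (p r : {poly int}) : (p - r) %% q = p %% q - r %% q.
  by rewrite Pdiv.IdomainUnit.modpD // Pdiv.IdomainUnit.modpN.
pose psi (v : 'rV[int]_n) := ((rVpoly v %% q)`_0, (rVpoly v %% q)`_1).
pose lin (x : int * int) : {poly int} := x.1%:P + x.2 *: 'X.
have lin_size x : (size (lin x) <= 2)%N.
  rewrite (leq_trans (size_polyD _ _)) // geq_max size_polyC.
  by rewrite (leq_trans (size_scale_leq _ _)) ?size_polyX //; case: eqP.
have linK x : psi (poly_rV (lin x)) = x.
  rewrite /psi poly_rV_K; last exact: leq_trans n_gt1.
  rewrite modp_small ?q_size ?ltnS // /lin !coefE /= mulr0 mulr1 addr0 add0r.
  by case: x.
have psiE v : lin (psi v) = rVpoly v %% q.
  have sz : (size (rVpoly v %% q)%R <= 2)%N.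
    by rewrite -ltnS -q_size ltn_modp monic_neq0.
  apply/polyP => -[|[|i]]; rewrite /lin /psi !coefE /= ?mulr0 ?mulr1 ?addr0 ?add0r //.
  by rewrite nth_default // (leq_trans sz).
(* Hence [psi] descends to the quotient, whatever words [ab_exponents] selects. *)
have psi_ker u v : ab_of u = ab_of v -> psi u = psi v.
  move/eqP; rewrite -subr_eq0 -raddfB => /eqP/ab_of_eq0/latE.
  by rewrite linearB /= modB => /subr0_eq; rewrite /psi => ->.
pose phi a := psi (ab_exponents a).
have phiB : zmod_morphism phi.
  move=> a b; rewrite /phi (psi_ker _ (ab_exponents a - ab_exponents b)).
    by rewrite /psi linearB /= modB !coefB.
  by rewrite raddfB /= !ab_exponentsK.
exists (HB.pack_for {additive Gab -> (int * int)%type} phi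
  (GRing.isZmodMorphism.Build _ _ phi phiB)).
exists (fun x => ab_of (poly_rV (lin x))) => [a|x] /=.
  rewrite -[RHS]ab_exponentsK /phi psiE; apply/eqP.
  rewrite -subr_eq0 -raddfB; apply/eqP/ab_of_eq0/latE.
  rewrite linearB /= modB poly_rV_K ?modp_id ?subrr //.
  by rewrite (leq_trans _ n_gt1) // -ltnS -q_size ltn_modp monic_neq0.
by rewrite /phi -[RHS]linK; apply: psi_ker; rewrite ab_exponentsK.
Qed.

End PresentedAbelianization.

(** * Growth of the resultant with [X^n - 1] *)

(** Both sides are the double product of [a - z] over the eigenvalues [a] of [M] and the roots [z]
    of [p]. *)
Lemma det_horner_mx (F : closedFieldType) (d : nat) (M : 'M[F]_d.+1)
    (rs : seq F) (p : {poly F}) :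
    char_poly M = \prod_(a <- rs) ('X - a%:P) -> p \is monic ->
  \det (horner_mx M p) = \prod_(a <- rs) p.[a].
Proof.
move=> charM p_monic; have [zs] := closed_field_poly_normal p.
rewrite (monicP p_monic) scale1r => ->.
have size_rs : size rs = d.+1.
  by have := size_char_poly M; rewrite charM size_prod_XsubC => -[].
have detB z : \det (horner_mx M ('X - z%:P)) = \prod_(a <- rs) (a - z).
  have -> : horner_mx M ('X - z%:P) = - (z%:M - M).
    by rewrite rmorphB /= horner_mx_X horner_mx_C opprB.
  rewrite -scaleN1r detZ.
  have -> : z%:M - M = map_mx (horner_eval z) (char_poly_mx M).
    apply/matrixP => i j; rewrite !mxE /horner_eval !hornerE.
    by rewrite hornerMn hornerX.
  rewrite det_map_mx -/(char_poly M) charM /= /horner_eval.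
  rewrite horner_prod -size_rs.
  (* The sign [(-1)^(d+1)] is distributed as one factor -1 per eigenvalue. *)
  rewrite -iter_mulr_1 -count_predT -big_const_seq -big_split /=.
  by apply: eq_bigr => a _; rewrite !hornerE mulN1r opprB.
rewrite rmorph_prod /=.
rewrite (big_morph determinant (@det_mulmx _ _) (det1 _ _)).
rewrite (eq_bigr _ (fun z _ => detB z)) exchange_big /=.
apply: eq_bigr => a _; rewrite horner_prod; apply: eq_bigr => z _.
by rewrite !hornerE.
Qed.

(** The dimension is put in successor form, as [horner_mx] requires. *)
Lemma companion_matrix_exists (d : nat) (g : {poly int}) :
  g \is monic -> size g = d.+2 -> exists M : 'M[int]_d.+1, char_poly M = g.
Proof.
move=> g_monic size_g; have := companionmxK g_monic.
move: (companionmx g); rewrite size_g /= => M; by exists M.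
Qed.

(* [|a^n - 1| >= ||a|^n - 1| = ||a| - 1| (1 + |a| + ... + |a|^(n-1))]. *)
Lemma norm_exp_sub1_ge (a : algC) (n : nat) :
  `| `|a| - 1 | * (\sum_(i < n) `|a| ^+ i) <= `|a ^+ n - 1|.
Proof.
have sum_ge0 : 0 <= \sum_(i < n) `|a| ^+ i by apply: sumr_ge0 => i _; apply: exprn_ge0.
rewrite -(ger0_norm sum_ge0) -normrM -subrX1 -normrX -[X in _ - X](normr1 algC).
exact: ler_dist_dist.
Qed.

(** The geometric sum is at least 1 for every root, by its constant term, and at least [n] for a
    root outside the unit circle. *)
Lemma prod_norm_exp_sub1_ge (rs : seq algC) (n : nat) :
    (0 < n)%N -> has (fun a => 1 < `|a|) rs ->
  n%:R * \prod_(a <- rs) `| `|a| - 1 | <= \prod_(a <- rs) `|a ^+ n - 1|.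
Proof.
move=> n_gt0 /hasP [b b_rs b_gt1].
have step (a : algC) : `| `|a| - 1 | <= `|a ^+ n - 1|.
  apply: le_trans _ (norm_exp_sub1_ge a n); rewrite ler_peMr //.
  case: n n_gt0 => // n _; rewrite big_ord_recl expr0 lerDl.
  by apply: sumr_ge0 => i _; apply: exprn_ge0.
rewrite !(big_rem b b_rs) /= mulrA; apply: ler_pM.
- by rewrite mulr_ge0.
- by apply: prodr_ge0.
- apply: le_trans _ (norm_exp_sub1_ge b n); rewrite mulrC ler_wpM2l //.
  rewrite -[n in n%:R]card_ord -sumr_const; apply: ler_sum => i _.
  by apply: exprn_ege1; apply: ltW.
by apply: ler_prod => a _; rewrite normr_ge0 step.
Qed.

Lemma coprime_cofactor_finite (g q : {poly int}) :
    g \is monic ->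
    (forall a : algC, root (map_poly intr g) a -> `|a| != 1) ->
    (exists2 a : algC, root (map_poly intr g) a & 1 < `|a|) ->
  finite_set [set n : nat | (0 < n)%N /\
    exists h a b : {poly int}, q * h = 'X^n - 1 /\ a * g + b * h = 1]%classic.
Proof.
move=> g_monic g_circle [a0 a0_root a0_gt1].
have gC_monic : map_poly (intr : int -> algC) g \is monic by apply: monic_map.
have size_g : (1 < size g)%N.
  rewrite -(@size_map_poly_id0 _ _ (intr : int -> algC) g); last first.
    by rewrite (monicP g_monic) oner_neq0.
  by apply: root_size_gt1 a0_root; apply: monic_neq0.
have [d size_gd] : exists d, size g = d.+2.
  by exists (size g).-2; case: (size g) size_g => [|[]].
have [M charM] := companion_matrix_exists g_monic size_gd.
pose phi := map_mx (intr : int -> algC) M.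
have [rs defg] := closed_field_poly_normal (map_poly (intr : int -> algC) g).
rewrite (monicP gC_monic) scale1r in defg.
have charMC : char_poly phi = \prod_(a <- rs) ('X - a%:P).
  by rewrite -defg /phi -map_char_poly charM.
have rs_root a : a \in rs = root (map_poly intr g) a.
  by rewrite defg root_prod_XsubC.
pose K := \prod_(a <- rs) `| `|a| - 1 |.
have K_gt0 : 0 < K.
  rewrite /K big_seq; apply: prodr_gt0 => a; rewrite rs_root => /g_circle.
  by rewrite normr_gt0 subr_eq0.
pose c : int := \det (horner_mx M q).
(* The growth estimate will give [n * K <= |c|], hence [n < N]. *)
pose N := Num.bound (`|c%:~R| / K : algC).
apply: (sub_finite_set _ (finite_II N)) => n [n_gt0 [h [a [b [qh bez]]]]] /=.
(* By Cayley-Hamilton [g(M) = 0], so the Bezout relation becomes [b(M) h(M) = 1]. *)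
have det_h : `|\det (horner_mx M h)| = 1.
  have gM0 : horner_mx M g = 0 by rewrite -charM; apply: Cayley_Hamilton.
  have := congr1 (fun p => \det (horner_mx M p)) bez.
  rewrite rmorphD !rmorphM /= gM0 mulr0 add0r rmorph1 det1 -mulmxE det_mulmx => e.
  have: (\det (horner_mx M h) %| 1)%Z by apply/dvdzP; exists (\det (horner_mx M b)).
  by rewrite dvdz1 => /eqP; lia.
have det_n : `|c%:~R| = \prod_(a <- rs) `|a ^+ n - 1| :> algC.
  rewrite -normr_prod.
  have -> : \prod_(a <- rs) (a ^+ n - 1) = \det (horner_mx phi ('X^n - 1)).
    rewrite (det_horner_mx charMC) -?polyC1 ?monicXnsubC //.
    by apply: eq_bigr => x _; rewrite !hornerE.
  have -> : 'X^n - 1 = map_poly (intr : int -> algC) ('X^n - 1).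
    by rewrite rmorphB /= map_polyXn rmorph1.
  rewrite -map_horner_mx det_map_mx -qh rmorphM /= -mulmxE det_mulmx.
  by rewrite rmorphM /= normrM -(intr_norm _ (\det (horner_mx M h))) det_h mulr1.
have has_gt1 : has (fun a => 1 < `|a|) rs by apply/hasP; exists a0; rewrite ?rs_root.
have := prod_norm_exp_sub1_ge n_gt0 has_gt1; rewrite -det_n -/K => le_nK.
have : n%:R < N%:R :> algC.
  apply: le_lt_trans _ (archi_boundP _); last by rewrite divr_ge0 // ltW.
  by rewrite ler_pdivlMr.
by rewrite ltr_nat.
Qed.

(** * The quotient by a common factor of [f] and [X^n - 1] *)

(** A zero resultant yields a non-constant common divisor, which has a complex root. *)
Lemma resultant_neq0 (g h : {poly int}) :
    (forall a : algC, root (map_poly intr g) a -> ~~ root (map_poly intr h) a) ->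
  resultant g h != 0.
Proof.
move=> no_root; apply/negP; rewrite resultant_eq0 => d_gt1.
set d := gcdp _ _ in d_gt1.
have [a da0] : exists a : algC, root (map_poly intr d) a.
  apply/closed_rootP; rewrite size_map_poly_id0 ?gtn_eqF //.
  by rewrite intr_eq0 lead_coef_eq0 -size_poly_gt0 ltnW.
(* Over the integers [%|] is divisibility up to a non-zero scalar [c], which does not affect
   roots. *)
have root_dvd p : d %| p -> root (map_poly intr p) a.
  case/Pdiv.Idomain.dvdpP => -[c r] /= c0 /(congr1 (map_poly (intr : int -> algC))).
  rewrite map_polyZ rmorphM /= => /(congr1 (horner^~ a)).
  rewrite hornerZ hornerM (rootP da0) mulr0 => /eqP.
  by rewrite mulf_eq0 intr_eq0 (negPf c0).
have := no_root a (root_dvd _ (dvdp_gcdl _ _)).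
by rewrite root_dvd // dvdp_gcdr.
Qed.

Section CommonFactor.

Variables (n : nat) (n_gt0 : (0 < n)%N) (q g h : {poly int}).
Hypothesis q_h : q * h = 'X^n - 1.

(** The resultant is a combination of [g] and [h], so its product with [q] lies in the ideal
    [(q g, q h)]. Saturation removes the resultant, and then [q] cancels. *)
Lemma saturated_bezout :
    (1 < size g)%N -> (1 < size h)%N -> resultant g h != 0 ->
    saturated (circulant_mx n (q * g)) ->
  exists a b : {poly int}, a * g + b * h = 1.
Proof.
move=> size_g size_h res0 satA.
have [[u v] _ /= res_uv] := resultant_in_ideal size_g size_h.
have /(row_lattice_circulant n_gt0) [a [b q_ab]] :
    row_lattice (circulant_mx n (q * g)) (cyclic_row n q).
  apply: (satA _ _ res0); rewrite -linearZ /=.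
  apply/(row_lattice_circulant n_gt0); exists u, v.
  by rewrite -mul_polyC res_uv -q_h mulrDl -!mulrA ![_ * q]mulrC.
have q0 : q != 0.
  apply/eqP => q0; move: q_h; rewrite q0 mul0r => /(congr1 (fun p => p.[0])).
  by rewrite !hornerE /= expr0n gtn_eqF.
exists a, b; apply: (mulfI q0); rewrite mulr1 [RHS]q_ab -q_h mulrDr.
by rewrite !(mulrCA q).
Qed.

(** The Bezout relation turns the ideal [(q g, q h)] into [(q)]. *)
Lemma row_lattice_bezout (v : 'rV[int]_n) :
    q \is monic -> (exists a b : {poly int}, a * g + b * h = 1) ->
  row_lattice (circulant_mx n (q * g)) v <-> rVpoly v %% q = 0.
Proof.
move=> q_monic [a [b bez]].
rewrite -{1}[v](cyclic_rowK n_gt0); split.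
  move=> /(row_lattice_circulant n_gt0) [a' [b' ->]].
  have -> : a' * (q * g) + b' * ('X^n - 1) = (a' * g + b' * h) * q.
    by rewrite -q_h; ring.
  exact: modp_mull.
move=> vq; have [p ->] : exists p, rVpoly v = p * q.
  by apply/(Pdiv.IdomainMonic.dvdpP q_monic)/modp_eq0P.
apply/(row_lattice_circulant n_gt0); exists (p * a), (p * b).
by rewrite -q_h -[LHS]mulr1 -bez; ring.
Qed.

End CommonFactor.

(** * The polynomial [X^m - X + 1] *)

Lemma XnBX1_monic_size (k : nat) :
  (1 < k)%N -> ('X^k - 'X + 1 : {poly int}) \is monic /\
               size ('X^k - 'X + 1 : {poly int}) = k.+1.
Proof.
move=> k_gt1; have sz : (size (1 - 'X : {poly int})%R < size ('X^k : {poly int})%R)%N.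
  by rewrite -opprB size_polyN -polyC1 size_XsubC size_polyXn.
have -> : 'X^k - 'X + 1 = 'X^k + (1 - 'X) :> {poly int} by ring.
by rewrite monicE lead_coefDl // lead_coefXn eqxx size_polyDl // size_polyXn.
Qed.

Lemma Phi6_dvd_Xn_sub1 (n : nat) :
  n = 0 %[mod 6] -> exists h : {poly int}, ('X^2 - 'X + 1) * h = 'X^n - 1.
Proof.
move=> n_mod6; have -> : n = (6 * (n %/ 6))%N by lia.
(* The first two factors are the cofactor of [X^2 - X + 1] in [X^6 - 1]; the sum is the cofactor of
   [X^6 - 1] in [X^n - 1]. *)
exists (('X^2 - 1) * ('X^2 + 'X + 1) * \sum_(i < n %/ 6) ('X^6) ^+ i).
by rewrite exprM [RHS]subrX1 mulrA; congr (_ * _); ring.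
Qed.

Lemma Phi6_dvd_XmBX1 (m : nat) :
  m = 2 %[mod 6] -> exists g : {poly int},
    ('X^2 - 'X + 1) * g = 'X^m - 'X + 1.
Proof.
move=> m_mod6; have [|h hE] := @Phi6_dvd_Xn_sub1 (m - 2); first by lia.
(* This comes from [X^m - X + 1 = X^2 (X^(m-2) - 1) + (X^2 - X + 1)]. *)
exists ('X^2 * h + 1); rewrite mulrDr mulrCA hE mulr1.
have {2}-> : m = (2 + (m - 2))%N by lia.
by rewrite exprD; ring.
Qed.

(* If [|a| = 1] and [a^m = a - 1] then [|a - 1| = 1] as well, so that [0], [1]
   and [a] form an equilateral triangle. *)
Lemma unit_circle_root_XmBX1 (m : nat) (a : algC) :
  `|a| = 1 -> a ^+ m - a + 1 = 0 -> a ^+ 2 - a + 1 = 0.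
Proof.
move=> a1 fa0; have am : a ^+ m = a - 1 by rewrite -[RHS]add0r -fa0; ring.
have := normCK (a - 1); rewrite -am normrX a1 !expr1n am rmorphB rmorph1.
have := normCK a; rewrite a1 expr1n; set b := a^* => ab ab1.
have abD : a + b = 1.
  have : (a - 1) * (b - 1) = a * b - (a + b) + 1 by ring.
  rewrite -ab1 -ab => e.
  by apply/eqP; rewrite eq_sym -subr_eq0 -(inj_eq (addIr 1)) -e add0r.
have -> : a ^+ 2 - a + 1 = a * (a + b) - a + (1 - a * b) by ring.
by rewrite abD -ab; ring.
Qed.

(** A root of [g] on the unit circle would also be a root of [X^2 - X + 1], hence a double root of
    [X^m - X + 1]. The derivative then gives [m a^(m-1) = 1], impossible for [|a| = 1] and
    [m > 1]. *)
Lemma cofactor_root_norm_neq1 (m : nat) (g : {poly int}) :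
    (1 < m)%N -> ('X^2 - 'X + 1) * g = 'X^m - 'X + 1 ->
  forall a : algC, root (map_poly intr g) a -> `|a| != 1.
Proof.
move=> m_gt1 gE a /rootP ga0; apply/eqP => a1.
pose toC := map_poly (intr : int -> algC).
have gCE : toC ('X^2 - 'X + 1) * toC g = 'X^m - 'X + 1.
  by rewrite -rmorphM gE /toC rmorphD rmorphB /= map_polyXn map_polyX rmorph1.
have qCE : toC ('X^2 - 'X + 1) = 'X^2 - 'X + 1.
  by rewrite /toC rmorphD rmorphB /= map_polyXn map_polyX rmorph1.
have fa0 : a ^+ m - a + 1 = 0.
  have := congr1 (horner^~ a) gCE; rewrite hornerM ga0 mulr0 => /esym.
  by rewrite !hornerE.
have qa0 : (toC ('X^2 - 'X + 1)).[a] = 0.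
  by rewrite qCE !hornerE (unit_circle_root_XmBX1 a1 fa0).
have := congr1 (fun p => (p^`()).[a]) gCE.
rewrite /= derivM hornerD !hornerM ga0 qa0 mulr0 mul0r addr0.
rewrite derivD derivB derivXn derivX -polyC1 derivC addr0.
rewrite !hornerE => /esym /eqP; rewrite subr_eq0 => /eqP /(congr1 Num.norm).
rewrite hornerMn hornerXn normrMn normrX a1 expr1n normr1 => /eqP.
by rewrite pnatr_eq1 gtn_eqF.
Qed.

(** The absolute values of the roots multiply to [|g(0)| = 1], so they cannot all be below 1. *)
Lemma root_norm_gt1_exists (g : {poly int}) :
    g \is monic -> (1 < size g)%N -> `|g.[0]| = 1 ->
    (forall a : algC, root (map_poly intr g) a -> `|a| != 1) ->
  exists2 a : algC, root (map_poly intr g) a & 1 < `|a|.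
Proof.
move=> g_monic size_g g0 g_circle.
pose gC := map_poly (intr : int -> algC) g.
have gC_monic : gC \is monic by apply: monic_map.
have [rs] := closed_field_poly_normal gC; rewrite (monicP gC_monic) scale1r => defg.
have rs_root a : a \in rs = root gC a by rewrite defg root_prod_XsubC.
have prod1 : \prod_(a <- rs) `|a| = 1.
  have : `|gC.[0]| = 1 by rewrite -(rmorph0 intr) horner_map /= -intr_norm g0.
  rewrite defg horner_prod normr_prod => e.
  by rewrite -[RHS]e; apply: eq_bigr => a _; rewrite !hornerE normrN.
case: (boolP (has (fun a => 1 < `|a|) rs)) => [/hasP [a]|/hasPn le1].
  by rewrite rs_root => ga a1; exists a.
have lt1 a : a \in rs -> `|a| < 1.
  move=> a_rs; rewrite lt_neqAle g_circle -?rs_root //=.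
  by rewrite real_leNgt ?rpred1 ?normr_real // le1.
have : (1 < size gC)%N.
  by rewrite size_map_poly_id0 // (monicP g_monic) oner_neq0.
move: prod1 lt1; rewrite defg size_prod_XsubC.
case: rs {defg rs_root le1} => // a s prod1 lt1 _.
have : \prod_(b <- a :: s) `|b| < 1.
  rewrite big_cons (le_lt_trans _ (lt1 a _)) ?mem_head // ler_piMr //.
  rewrite big_seq; apply: prodr_ile1 => b b_s; rewrite normr_ge0 ltW // lt1 //.
  by rewrite inE b_s orbT.
by rewrite prod1 ltxx.
Qed.

Theorem theorem5p4 (m : nat) (m_ge8 : (8 <= m)%N) (m_mod6 : m = 2 %[mod 6]) :
  let f : {poly int} := 'X^m - 'X + 1 in
  finite_set [set n : nat |
    [/\ (0 < n)%N, n = 0 %[mod 6] & last_detdiv (circulant_mx n f) = 1%N]]%classic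
  /\ (forall n : nat, (0 < n)%N -> n = 0 %[mod 6] ->
       (last_detdiv (circulant_mx n f) = 1%N
        <-> zmod_iso (abelianization (gilbert_howie n m)) (int * int)%type)).
Proof.
move=> f; have [g gE] := Phi6_dvd_XmBX1 m_mod6.
have [q_monic size_q] := XnBX1_monic_size (isT : (1 < 2)%N).
have [f_monic size_f] := XnBX1_monic_size (ltn_trans (isT : (1 < 7)%N) m_ge8).
have g_monic : g \is monic by rewrite -(monicMl g q_monic) gE.
have size_g : (1 < size g)%N.
  have := size_f; rewrite -gE size_monicM ?monic_neq0 // size_q.
  by move: m_ge8; clear; lia.
have g_circle := cofactor_root_norm_neq1 (ltn_trans (isT : (1 < 7)%N) m_ge8) gE.
have g0 : g.[0] = 1.
  have := congr1 (horner^~ 0) gE; rewrite hornerM !hornerE.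
  by rewrite expr0n gtn_eqF ?(ltn_trans _ m_ge8) // add0r.
have g_gt1 : exists2 a : algC, root (map_poly intr g) a & 1 < `|a|.
  by apply: root_norm_gt1_exists; rewrite ?g0 ?normr1.
have bezout n : (0 < n)%N -> n = 0 %[mod 6] -> last_detdiv (circulant_mx n f) = 1%N ->
    exists2 h : {poly int}, ('X^2 - 'X + 1) * h = 'X^n - 1 &
      exists a b : {poly int}, a * g + b * h = 1.
  move=> n_gt0 n_mod6 /last_detdiv_eq1; have [h hE] := Phi6_dvd_Xn_sub1 n_mod6.
  rewrite /f -gE => satA; exists h => //; apply: saturated_bezout satA => //.
    (* Here [n] is at least 6, so [h], of degree [n - 2], is not constant. *)
    have := size_XnsubC (1 : int) n_gt0; rewrite polyC1 -hE.
    have [->|h0] := eqVneq h 0; first by rewrite mulr0 size_poly0.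
    rewrite size_monicM // size_q.
    by move: (size h) n_gt0 n_mod6 => k; clear; lia.
  (* The roots of [h] are roots of unity, while those of [g] avoid the unit circle. *)
  apply: resultant_neq0 => a /g_circle a1; apply/negP => /rootP ha0; case/negP: a1.
  have := congr1 (fun p => (map_poly (intr : int -> algC) p).[a]) hE.
  rewrite rmorphM hornerM ha0 mulr0 rmorphB /= map_polyXn rmorph1 !hornerE.
  move=> /esym/eqP; rewrite subr_eq0 => /eqP /(congr1 Num.norm).
  by rewrite normrX normr1 => /eqP; rewrite pexpr_eq1.
split.
  apply: sub_finite_set
    (coprime_cofactor_finite ('X^2 - 'X + 1) g_monic g_circle g_gt1).
  move=> n [n_gt0 n_mod6 /bezout] [] // h hE [a [b bez]]; split=> //.
  by exists h, a, b.
move=> n n_gt0 n_mod6.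
have Xrow k (i : 'I_n) : cyclic_row n 'X^(i + k) = delta_mx 0 (@ord_shift n k i).
  by apply: cyclic_row_Xn.
(* Row [i] represents [X^i f = X^i + X^(i+m) - X^(i+1)], which spells the [i]-th relator. *)
have row_exponents i : row i (circulant_mx n f) =
    exponents [:: (i, true); (ord_shift m i, true); (ord_shift 1 i, false)].
  rewrite row_circulant // /f mulrDr mulrBr mulr1 -exprD -exprSr -[i.+1]addn1.
  rewrite !(linearD, linearN) /= !Xrow.
  rewrite (@cyclic_row_Xn _ n_gt0 _ i) ?modn_small //.
  by rewrite /exponents !big_cons big_nil addr0 /letter_exponent /= addrC.
have rel_lattice w : GH_relators m w -> row_lattice (circulant_mx n f) (exponents w).
  by move=> [i ->]; rewrite -row_exponents; exists (delta_mx 0 i); rewrite -rowE.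
have row_rel i : exists2 w, GH_relators m w & row i (circulant_mx n f) = exponents w.
  by eexists; last exact: row_exponents; exists i.
split=> [/bezout [] // h hE bez|iso].
  apply: (quadratic_quotient_zmod_iso rel_lattice row_rel _ q_monic size_q).
    by move: n_gt0 n_mod6; clear; lia.
  by move=> v; rewrite /f -gE; apply: (row_lattice_bezout n_gt0 hE).
by apply/last_detdiv_eq1; apply: zmod_iso_saturated iso.
Qed.
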